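(* The Hanoi towers group $\Gamma=\langle a,b,c\rangle\le\mathrm{Aut}(X^* )$ is self-replicating, i.e. for every vertex $u$ of $X^*$ one has $\mathrm{Stab}_\Gamma(u)@u=\Gamma$.
   Context: Let $X=\{1,2,3\}$ and let $X^*$ be the infinite rooted ternary tree: its vertices are the finite words over $X$, the root is the empty word $\varnothing$, and each word $w$ is joined to $wx$ for $x\in X$. $\mathrm{Aut}(X^* )$ is the group of root-preserving, edge-preserving bijections of the vertex set; it acts on the right, $u\mapsto u^g$. For $g\in\mathrm{Aut}(X^* )$ and a vertex $u$, the state $g@u\in\mathrm{Aut}(X^* )$ is the automorphism determined by $(uw)^g=u^g\,w^{g@u}$ for all words $w$; for a subset $S\subseteq \mathrm{Aut}(X^* )$, $S@u=\{g@u: g\in S\}$. One writes $g=(g_1,g_2,g_3)\sigma$ when $g_i=g@i$ for $i\in X$ and $\sigma\in S_3$ is the permutation by which $g$ acts on the first level $X$. The Hanoi towers group is $\Gamma=\langle a,b,c\rangle$, where $a,b,c\in\mathrm{Aut}(X^* )$ are defined recursively by $a=(a,1,1)\sigma_{23}$, $b=(1,b,1)\sigma_{13}$, $c=(1,1,c)\sigma_{12}$, with $\sigma_{ij}$ the transposition of $i$ and $j$. For $G\le\mathrm{Aut}(X^* )$ and a vertex $u$, $\mathrm{Stab}_G(u)$ is the subgroup of elements of $G$ fixing $u$. $G$ is called self-replicating if $\mathrm{Stab}_G(u)@u=G$ for every vertex $u$. *)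

(* Defs.v *)
From HB Require Import structures.
From mathcomp Require Import all_boot all_fingroup.
From mathcomp Require Import boolp classical_sets.

Set Implicit Arguments.
Unset Strict Implicit.
Unset Printing Implicit Defensive.

Local Open Scope classical_set_scope.
Local Open Scope group_scope.

Definition X : finType := 'I_3.
Definition x1 : X := @Ordinal 3 0 isT.
Definition x2 : X := @Ordinal 3 1 isT.
Definition x3 : X := @Ordinal 3 2 isT.

(* Vertices of the ternary tree: [rcons u x] is the child of u labelled x. *)
Definition word := seq X.

Definition adjacent (u v : word) : Prop :=
  exists x, v = rcons u x \/ u = rcons v x.

Record tree_aut := TreeAut {
  aut_fun :> word -> word;
  aut_bij : bijective aut_fun;
  aut_root : aut_fun [::] = [::];
  aut_adj : forall u v, adjacent (aut_fun u) (aut_fun v) <-> adjacent u v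
}.

Lemma tree_autP (g h : tree_aut) : g =1 h -> g = h.
Proof.
case: g h => [g bg rg ag] [h bh rh ah] /= /funext gh; subst h.
by congr TreeAut; apply: Prop_irrelevance.
Qed.

HB.instance Definition _ := gen_eqMixin tree_aut.
HB.instance Definition _ := gen_choiceMixin tree_aut.

Definition one_aut : tree_aut.
Proof. by exists id => //; exists id. Defined.

(* Right action: a product applies its left factor first. *)
Definition mul_aut (g h : tree_aut) : tree_aut.
Proof.
exists (h \o g).
- by apply: bij_comp; apply: aut_bij.
- by rewrite /= !aut_root.
- by move=> u v; rewrite /= !aut_adj.
Defined.

Lemma inv_exists (g : tree_aut) :
  exists h : tree_aut, cancel g h /\ cancel h g.
Proof.
have [f gK fK] := aut_bij g.
have bf : bijective f by exists g.
have rf : f [::] = [::] by rewrite -{1}(aut_root g) gK.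
have af u v : adjacent (f u) (f v) <-> adjacent u v.
  by rewrite -(aut_adj g) !fK.
by exists (TreeAut bf rf af).
Qed.

Definition inv_aut (g : tree_aut) : tree_aut := projT1 (cid (inv_exists g)).

Lemma aut_mulA : associative mul_aut.
Proof. by move=> f g h; apply: tree_autP. Qed.
Lemma aut_mul1 : left_id one_aut mul_aut.
Proof. by move=> g; apply: tree_autP. Qed.
Lemma aut_mulr1 : right_id one_aut mul_aut.
Proof. by move=> g; apply: tree_autP. Qed.
Lemma aut_mulV : left_inverse one_aut inv_aut mul_aut.
Proof.
by move=> g; apply: tree_autP => w; have [_] := projT2 (cid (inv_exists g)); apply.
Qed.
Lemma aut_mulrV : right_inverse one_aut inv_aut mul_aut.
Proof.
by move=> g; apply: tree_autP => w; have [+ _] := projT2 (cid (inv_exists g)); apply.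
Qed.

HB.instance Definition _ := isGroup.Build tree_aut
  aut_mulA aut_mul1 aut_mulr1 aut_mulV aut_mulrV.

Lemma mul_autE (g h : tree_aut) w : (g * h) w = h (g w).
Proof. by []. Qed.

Lemma one_autE w : (1 : tree_aut) w = w.
Proof. by []. Qed.

Lemma aut_invK (g : tree_aut) : cancel g g^-1.
Proof. by move=> w; rewrite -mul_autE mulgV. Qed.

Lemma aut_rcons (g : tree_aut) w x : exists y, g (rcons w x) = rcons (g w) y.
Proof.
elim/last_ind: w x => [|w z IH] x.
  have : adjacent (g [::]) (g [:: x]) by apply/aut_adj; exists x; left.
  by rewrite aut_root => -[y [->|]]; [exists y | case: (g _)].
have : adjacent (g (rcons w z)) (g (rcons (rcons w z) x)).
  by apply/aut_adj; exists x; left.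
case=> y [->|]; first by exists y.
have [t ->] := IH z => /rcons_inj [/(bij_inj (aut_bij g))/(congr1 size)].
by rewrite !size_rcons => /eqP; rewrite -addn2 -[X in X == _]addn0 eqn_add2l.
Qed.

Lemma size_aut (g : tree_aut) w : size (g w) = size w.
Proof.
elim/last_ind: w => [|w x IH]; first by rewrite aut_root.
by have [y ->] := aut_rcons g w x; rewrite !size_rcons IH.
Qed.

(* For a tree automorphism g, g (u ++ w) has prefix g u, of size [size u]. *)
Definition state_fun (g : word -> word) (u w : word) : word :=
  drop (size u) (g (u ++ w)).

Lemma state_funE (g : tree_aut) u w : g (u ++ w) = g u ++ state_fun g u w.
Proof.
rewrite -[LHS](cat_take_drop (size u)); congr (_ ++ _).
elim/last_ind: w => [|w x IH]; first by rewrite cats0 take_oversize ?size_aut.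
rewrite -rcons_cat; have [y ->] := aut_rcons g (u ++ w) x.
by rewrite -cats1 takel_cat // size_aut size_cat leq_addr.
Qed.

Lemma state_bij (g : tree_aut) u : bijective (state_fun g u).
Proof.
have half (h h' : tree_aut) (v : word) :
    cancel h h' -> cancel (state_fun h v) (state_fun h' (h v)).
  move=> hK w; apply/eqP.
  by rewrite {1}/state_fun -state_funE hK size_aut drop_size_cat.
exists (state_fun g^-1 (g u)); first by apply: half; apply: aut_invK.
have := half g^-1 g (g u); rewrite aut_invK; apply => w.
by rewrite -mul_autE mulVg.
Qed.

Lemma adjacent_cat u v w : adjacent (u ++ v) (u ++ w) <-> adjacent v w.
Proof.
split=> -[x]; last by case=> ->; exists x; [left|right]; rewrite rcons_cat.
by rewrite !rcons_cat => -[] /eqP; rewrite eqseq_cat // => /andP[_ /eqP ->];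
  exists x; [left|right].
Qed.

Lemma state_adj (g : tree_aut) u v w :
  adjacent (state_fun g u v) (state_fun g u w) <-> adjacent v w.
Proof.
by rewrite -(adjacent_cat (g u)) -!state_funE aut_adj adjacent_cat.
Qed.

Lemma state_root (g : tree_aut) u : state_fun g u [::] = [::].
Proof. by rewrite /state_fun cats0 drop_oversize ?size_aut. Qed.

Definition state (g : tree_aut) (u : word) : tree_aut :=
  TreeAut (state_bij g u) (state_root g u) (state_adj g u).

Notation "g @ u" := (state g u) (at level 30, no associativity) : group_scope.

Lemma stateP (g : tree_aut) u w : g (u ++ w) = g u ++ (g @ u) w.
Proof. exact: state_funE. Qed.

Lemma state_uniq (g h : tree_aut) u :
  (forall w, g (u ++ w) = g u ++ h w) -> g @ u = h.
Proof.
move=> gh; apply: tree_autP => w; apply/eqP.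
by have /eqP := gh w; rewrite stateP eqseq_cat // => /andP[].
Qed.

(* [hanoi_fun i s] is the recursively defined g = (g_1, g_2, g_3) s with g_i = g
   and the other two states trivial; see [hanoi_level1] and [hanoi_state]. *)
Fixpoint hanoi_fun (i : X) (s : {perm X}) (w : word) : word :=
  if w is x :: w' then s x :: (if x == i then hanoi_fun i s w' else w')
  else [::].

Lemma hanoi_bij i s : bijective (hanoi_fun i s).
Proof.
pose fix f (w : word) : word :=
  if w is y :: w' then
    s^-1 y :: (if s^-1 y == i then f w' else w') else [::].
exists f; elim=> //= x w IH.
  by rewrite permK; case: (x == i); rewrite ?IH.
by rewrite permKV; case: (s^-1 x == i); rewrite ?IH.
Qed.

Lemma hanoi_rcons i s w x :
  exists y, hanoi_fun i s (rcons w x) = rcons (hanoi_fun i s w) y.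
Proof.
elim: w => [|z w [y IH]] /=; first by exists (s x); rewrite if_same.
by case: ifP => _; [exists y; rewrite IH | exists x].
Qed.

Lemma hanoi_adj i s u v :
  adjacent (hanoi_fun i s u) (hanoi_fun i s v) <-> adjacent u v.
Proof.
set f := hanoi_fun i s.
have fI : injective f := bij_inj (hanoi_bij i s).
have sz w : size (f w) = size w.
  by elim: w => //= x w IH; case: ifP => //= _; rewrite IH.
have lift w w' y : f w' = rcons (f w) y -> exists x, w' = rcons w x.
  case/lastP: w' => [|w' x] /= fw; first by move: (congr1 size fw); rewrite size_rcons.
  have [z fw'] := hanoi_rcons i s w' x; move: fw; rewrite /f fw'.
  by move=> /rcons_inj[/fI -> _]; exists x.
split=> -[x [e|e]].
- by have [y ->] := lift _ _ _ e; exists y; left.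
- by have [y ->] := lift _ _ _ e; exists y; right.
- by rewrite e; have [y E] := hanoi_rcons i s u x; exists y; left.
- by rewrite e; have [y E] := hanoi_rcons i s v x; exists y; right.
Qed.

Definition hanoi (i : X) (s : {perm X}) : tree_aut :=
  @TreeAut (hanoi_fun i s) (hanoi_bij i s) erefl (hanoi_adj i s).

Lemma hanoi_level1 i s x : hanoi i s [:: x] = [:: s x].
Proof. by rewrite /= if_same. Qed.

Lemma hanoi_state i s x :
  hanoi i s @ [:: x] = if x == i then hanoi i s else 1.
Proof.
apply: state_uniq => w /=; rewrite if_same /=.
by case: ifP.
Qed.

Definition a : tree_aut := hanoi x1 (tperm x2 x3).
Definition b : tree_aut := hanoi x2 (tperm x1 x3).
Definition c : tree_aut := hanoi x3 (tperm x1 x2).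

Definition is_subgroup (H : set tree_aut) : Prop :=
  group_closed (mem H).

Definition generated (S : set tree_aut) : set tree_aut :=
  smallest is_subgroup S.

Lemma generated_subgroup S : is_subgroup (generated S).
Proof.
split; first by rewrite inE => H [[]]; rewrite inE.
move=> g h; rewrite !inE => gS hS H HS; have [[_ Hd] _] := HS.
by apply/set_mem/Hd; apply/mem_set; [apply: gS | apply: hS].
Qed.

Definition Gamma : set tree_aut := generated [set a; b; c].

Definition stab (G : set tree_aut) (u : word) : set tree_aut :=
  [set g | G g /\ g u = u].

Definition states (S : set tree_aut) (u : word) : set tree_aut :=
  [set g @ u | g in S].

Definition self_replicating (G : set tree_aut) : Prop :=
  forall u : word, states (stab G u) u = G.

(* Main.v *)
From mathcomp Require Import all_boot all_fingroup.
From mathcomp Require Import boolp classical_sets.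
Require Import Defs.

Set Implicit Arguments.
Unset Strict Implicit.
Unset Printing Implicit Defensive.

Local Open Scope classical_set_scope.
Local Open Scope group_scope.

(** Taking states at a fixed vertex [u] is a homomorphism on the stabiliser of
    [u], so the states at [u] of the stabiliser of [u] in a group form a group.
    Since [g @ (x :: v)] is [(g @ [:: x]) @ v], an element of the stabiliser of
    [x :: v] can be assembled one letter at a time, and it suffices to treat
    vertices of the first level ([self_replicating_level1]).

    At such a vertex [x], it then suffices to find each generator among the
    states at [x] of the stabiliser of [x].  The generator with its own copy
    at [x] fixes [x], so it is its own state there.  The generator whose copy
    is at another vertex [y] is moved to [x] by conjugation: the third
    generator exchanges [x] and [y] with trivial states at both, so
    conjugating by it carries the state at [y] to [x], unchanged
    ([hanoi_conj]).

    Conversely, states at any vertex of elements of the group stay in the group,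
    because the generators have only themselves and [1] as states at letters
    ([generated_state1]). *)

Lemma state_nil (g : tree_aut) : g @ [::] = g.
Proof. by apply: state_uniq => w; rewrite aut_root. Qed.

Lemma state_cat (g : tree_aut) u v : g @ (u ++ v) = (g @ u) @ v.
Proof. by apply: state_uniq => w; rewrite -catA !stateP catA. Qed.

Lemma state1 u : (1 : tree_aut) @ u = 1.
Proof. exact: state_uniq. Qed.

Lemma stateM (g h : tree_aut) u : (g * h) @ u = (g @ u) * (h @ (g u)).
Proof. by apply: state_uniq => w; rewrite !mul_autE !stateP. Qed.

Lemma stateV (g : tree_aut) u : g^-1 @ u = (g @ (g^-1 u))^-1.
Proof.
by apply: (mulIg (g @ (g^-1 u))); rewrite -stateM !mulVg state1.
Qed.

Lemma aut_letter (g : tree_aut) x : exists y, g [:: x] = [:: y].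
Proof. by have := aut_rcons g [::] x; rewrite aut_root. Qed.

Lemma is_subgroupI (H : set tree_aut) :
  H 1 -> (forall g h, H g -> H h -> H (g * h^-1)) -> is_subgroup H.
Proof.
by move=> H1 HD; split=> [|g h]; rewrite !inE //; apply: HD.
Qed.

Lemma is_subgroupP (H : set tree_aut) : is_subgroup H ->
  [/\ H 1, forall g h, H g -> H h -> H (g * h) & forall g, H g -> H g^-1].
Proof.
case; rewrite inE => H1 HD.
have HDp g h : H g -> H h -> H (g * h^-1).
  by move=> Hg Hh; apply/set_mem/HD; apply/mem_set.
have HV g : H g -> H g^-1 by move=> Hg; rewrite -[g^-1]mul1g; apply: HDp.
by split=> // g h Hg Hh; rewrite -[h]invgK; apply/HDp/HV.
Qed.

Lemma generated_min (S H : set tree_aut) :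
  is_subgroup H -> S `<=` H -> generated S `<=` H.
Proof. exact: smallest_sub. Qed.

Lemma states_stab_subgroup (G : set tree_aut) u :
  is_subgroup G -> is_subgroup (states (stab G u) u).
Proof.
move=> /is_subgroupP[G1 GM GV]; apply: is_subgroupI.
  by exists 1; rewrite ?state1.
move=> _ _ [g [Gg gu] <-] [h [Gh hu] <-].
have hVu : h^-1 u = u by rewrite -{1}hu aut_invK.
exists (g * h^-1); first by split; [apply/GM/GV | rewrite mul_autE gu hVu].
by rewrite stateM gu stateV hVu.
Qed.

(** The states of a product or an inverse are products and inverses of states
    at possibly other letters; this is why the set shown to be a subgroup
    quantifies over all letters at once. *)
Lemma generated_state1 (S : set tree_aut) :
  (forall g x, S g -> generated S (g @ [:: x])) ->
  forall g x, generated S g -> generated S (g @ [:: x]).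
Proof.
move=> Sx g x Gg; move: g Gg x.
have [G1 GM GV] := is_subgroupP (@generated_subgroup S).
apply: (@generated_min S [set g | forall x, generated S (g @ [:: x])]).
  apply: is_subgroupI => /= [x|g h Hg Hh x]; first by rewrite state1.
  rewrite stateM stateV; apply: (GM) => //; apply: GV.
  have [y ->] := aut_letter g x.
  by have [z ->] := aut_letter h^-1 y; apply: Hh.
by move=> g Sg x; apply: Sx.
Qed.

(** Both inclusions go by induction on the vertex.  For the second one, [h] is
    first realised below the first letter as a state of some [k] in [G], which
    is in turn realised as a state at the first letter. *)
Lemma self_replicating_level1 (G : set tree_aut) :
  (forall g x, G g -> G (g @ [:: x])) ->
  (forall x, G `<=` states (stab G [:: x]) [:: x]) ->
  self_replicating G.
Proof.
move=> Gx Gstab u; apply/seteqP; split.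
  move=> _ [g [Gg _] <-].
  elim: u g Gg => [|x u IH] g Gg; first by rewrite state_nil.
  by rewrite -cat1s state_cat; apply/IH/Gx.
elim: u => [|x u IH] h Gh.
  by exists h; [split; rewrite ?aut_root | rewrite state_nil].
have [k [Gk ku] kh] := IH h Gh.
have [g [Gg gx] gk] := Gstab x k Gk.
exists g; first by split=> //; rewrite -cat1s stateP gx gk ku.
by rewrite -cat1s state_cat gk.
Qed.

Lemma hanoi_stab i (s : {perm X}) : s i = i ->
  hanoi i s [:: i] = [:: i] /\ hanoi i s @ [:: i] = hanoi i s.
Proof. by move=> si; rewrite hanoi_level1 hanoi_state si eqxx. Qed.

(** The path of [x] is [x], [y], [y], [x]; the outer factors contribute the
    trivial state, because their own copy sits at [i]. *)
Lemma hanoi_conj i (s t : {perm X}) x y :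
  x != i -> y != i -> s x = y -> s y = x -> t y = y ->
  (hanoi i s * hanoi y t * hanoi i s) [:: x] = [:: x] /\
  (hanoi i s * hanoi y t * hanoi i s) @ [:: x] = hanoi y t.
Proof.
move=> /negPf xi /negPf yi sx sy ty; split.
  by rewrite !mul_autE !hanoi_level1 sx ty sy.
rewrite !stateM !mul_autE !hanoi_level1 !hanoi_state sx ty xi yi eqxx.
by rewrite mul1g mulg1.
Qed.

Lemma Gamma_gen : [/\ Gamma a, Gamma b & Gamma c].
Proof.
by split; apply: sub_gen_smallest; [left; left | left; right | right].
Qed.

Lemma Gamma_states_stab1 x : Gamma `<=` states (stab Gamma [:: x]) [:: x].
Proof.
have [_ GM _] := is_subgroupP (@generated_subgroup [set a; b; c]).
have [Ga Gb Gc] := Gamma_gen.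
apply: generated_min; first exact/states_stab_subgroup/generated_subgroup.
have own i (s : {perm X}) : s i = i -> Gamma (hanoi i s) ->
    states (stab Gamma [:: i]) [:: i] (hanoi i s).
  by move=> /(hanoi_stab (s := s))[gi gs] Gg; exists (hanoi i s).
have other i (s t : {perm X}) y z :
    z != i -> y != i -> s z = y -> s y = z -> t y = y ->
    Gamma (hanoi i s) -> Gamma (hanoi y t) ->
    states (stab Gamma [:: z]) [:: z] (hanoi y t).
  move=> zi yi sz sy ty Gg Gh; have [gz gs] := hanoi_conj zi yi sz sy ty.
  exists (hanoi i s * hanoi y t * hanoi i s) => //.
  by split=> //; apply: (GM) => //; apply: (GM).
have [->|->|->] : [\/ x = x1, x = x2 | x = x3].
  case: x => [[|[|[|//]]] ?];
    [apply: Or31 | apply: Or32 | apply: Or33]; exact: val_inj.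
(* At each letter, [other] takes the generator that moves it to the place of
   the copy being carried over. *)
- move=> _ [[]|] ->.
  + by apply: own; rewrite ?tpermD.
  + by apply: (other _ _ _ _ _ _ _ _ _ _ Gc); rewrite ?tpermL ?tpermR ?tpermD.
  + by apply: (other _ _ _ _ _ _ _ _ _ _ Gb); rewrite ?tpermL ?tpermR ?tpermD.
- move=> _ [[]|] ->.
  + by apply: (other _ _ _ _ _ _ _ _ _ _ Gc); rewrite ?tpermL ?tpermR ?tpermD.
  + by apply: own; rewrite ?tpermD.
  + by apply: (other _ _ _ _ _ _ _ _ _ _ Ga); rewrite ?tpermL ?tpermR ?tpermD.
- move=> _ [[]|] ->.
  + by apply: (other _ _ _ _ _ _ _ _ _ _ Gb); rewrite ?tpermL ?tpermR ?tpermD.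
  + by apply: (other _ _ _ _ _ _ _ _ _ _ Ga); rewrite ?tpermL ?tpermR ?tpermD.
  + by apply: own; rewrite ?tpermD.
Qed.

Theorem lemma2 : self_replicating Gamma.
Proof.
apply: self_replicating_level1; last exact: Gamma_states_stab1.
have [G1 _ _] := is_subgroupP (@generated_subgroup [set a; b; c]).
have [Ga Gb Gc] := Gamma_gen.
by apply: generated_state1 => g x [[]|] ->; rewrite hanoi_state; case: ifP.
Qed.
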